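(* Among the five platonic solids (regular polyhedra), the simplicial ones, namely the tetrahedron, the octahedron and the icosahedron, are coherently labellable, and the other two, namely the dodecahedron and the cube, are not coherently labellable.
   Context: For a convex polyhedron, each face $F$ is oriented by the outward normal, so its boundary edges are traversed anticlockwise as seen from outside. A labelling of all the edges by integers is coherent if, for each face $F$ with $n_F$ edges, there is a choice of starting edge such that the successive labels read anticlockwise from that edge satisfy $a_1<a_2<\cdots<a_{n_F}$. The polyhedron is coherently labellable if it has a coherent labelling. *)

(* Defs.v *)
From mathcomp Require Import all_boot all_order all_algebra.
From mathcomp Require Import boolp classical_sets reals.

Set Implicit Arguments.
Unset Strict Implicit.
Unset Printing Implicit Defensive.

Import Order.TTheory GRing.Theory Num.Theory.
Local Open Scope ring_scope.
Local Open Scope classical_set_scope.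

Section Polyhedra.
Variable R : realType.

Definition vec3 : Type := 'rV[R]_3.

Definition pt (x y z : R) : vec3 := \row_(i < 3) [:: x; y; z]`_i.

Definition dot (u v : vec3) : R := \sum_i u 0 i * v 0 i.

(* The determinant of the matrix with rows u, v, w; it is positive exactly when
   (u, v, w) is a right-handed frame. *)
Definition det3 (u v w : vec3) : R := \det (col_mx u (col_mx v w)).

Definition conv_hull (s : seq vec3) : set vec3 :=
  [set x | exists w : 'I_(size s) -> R,
     [/\ forall i, 0 <= w i, \sum_i w i = 1 & x = \sum_i w i *: s`_i]].

Definition segment (a b : vec3) : set vec3 := conv_hull [:: a; b].

Definition noncollinear (F : set vec3) : Prop :=
  exists a b c, [/\ F a, F b, F c & row_free (col_mx (b - a) (c - a))].

(* In the following definitions P is meant to be a convex polyhedron with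
   nonempty interior, seen as a solid body in R^3. *)

(* F is the intersection of P with a supporting plane of outward normal n. *)
Definition supporting (P : set vec3) (n : vec3) (F : set vec3) : Prop :=
  n != 0 /\
  exists2 c : R, (forall x, P x -> dot n x <= c)
               & F = P `&` [set x | dot n x = c].

(* F is a (two-dimensional) face of P, with outward normal n; n is determined
   by F up to a positive factor. *)
Definition face (P : set vec3) (n : vec3) (F : set vec3) : Prop :=
  supporting P n F /\ noncollinear F.

Definition edge (P : set vec3) (E : set vec3) : Prop :=
  (exists n, supporting P n E) /\ exists a b, a != b /\ E = segment a b.

(* The directed sides of the closed polygon with successive vertices v. *)
Definition sides (v : seq vec3) : seq (vec3 * vec3) := zip v (rot 1 v).

(* v lists the vertices of the face F of P, whose outward normal is n,
   anticlockwise as seen from outside: the sides of v are the edges of P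
   bounding F, and F lies to the left of each of them for an observer at whom
   n points. The choice of the first element of v is the choice of a starting
   edge. *)
Definition anticlockwise (P : set vec3) (n : vec3) (F : set vec3)
    (v : seq vec3) : Prop :=
  [/\ uniq v,
      forall E, (edge P E /\ E `<=` F) <->
                (exists2 p, p \in sides v & E = segment p.1 p.2)
    & forall p x, p \in sides v -> F x ->
                  0 <= det3 (p.2 - p.1) (x - p.1) n].

(* Only the values of lab at the edges of P matter. *)
Definition coherent (P : set vec3) (lab : set vec3 -> int) : Prop :=
  forall n F, face P n F ->
    exists v, anticlockwise P n F v /\
      sorted <%R [seq lab (segment p.1 p.2) | p <- sides v].

Definition coherently_labellable (P : set vec3) : Prop :=
  exists lab : set vec3 -> int, coherent P lab.

Definition simplicial (P : set vec3) : Prop :=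
  forall n F, face P n F -> exists a b c, F = conv_hull [:: a; b; c].

(* P is the image of Q under a similarity (possibly orientation-reversing). *)
Definition similar_bodies (P Q : set vec3) : Prop :=
  exists (k : R) (O : 'M[R]_3) (t : vec3),
    [/\ 0 < k, O *m O^T = 1%:M & P = [set k *: (x *m O) + t | x in Q]].

Definition golden : R := (1 + Num.sqrt 5) / 2.

Definition tetrahedron_vertices : seq vec3 :=
  [:: pt 1 1 1; pt 1 (-1) (-1); pt (-1) 1 (-1); pt (-1) (-1) 1].

Definition cube_vertices : seq vec3 :=
  [:: pt 1 1 1; pt 1 1 (-1); pt 1 (-1) 1; pt 1 (-1) (-1);
      pt (-1) 1 1; pt (-1) 1 (-1); pt (-1) (-1) 1; pt (-1) (-1) (-1)].

Definition octahedron_vertices : seq vec3 :=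
  [:: pt 1 0 0; pt (-1) 0 0; pt 0 1 0; pt 0 (-1) 0; pt 0 0 1; pt 0 0 (-1)].

Definition icosahedron_vertices : seq vec3 :=
  let g := golden in
  [:: pt 0 1 g; pt 0 1 (- g); pt 0 (-1) g; pt 0 (-1) (- g);
      pt 1 g 0; pt 1 (- g) 0; pt (-1) g 0; pt (-1) (- g) 0;
      pt g 0 1; pt (- g) 0 1; pt g 0 (-1); pt (- g) 0 (-1)].

Definition dodecahedron_vertices : seq vec3 :=
  let g := golden in let h := golden^-1 in
  cube_vertices ++
  [:: pt 0 h g; pt 0 h (- g); pt 0 (- h) g; pt 0 (- h) (- g);
      pt h g 0; pt h (- g) 0; pt (- h) g 0; pt (- h) (- g) 0;
      pt g 0 h; pt (- g) 0 h; pt g 0 (- h); pt (- g) 0 (- h)].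

Definition tetrahedron (P : set vec3) : Prop :=
  similar_bodies P (conv_hull tetrahedron_vertices).

Definition cube (P : set vec3) : Prop :=
  similar_bodies P (conv_hull cube_vertices).

Definition octahedron (P : set vec3) : Prop :=
  similar_bodies P (conv_hull octahedron_vertices).

Definition icosahedron (P : set vec3) : Prop :=
  similar_bodies P (conv_hull icosahedron_vertices).

Definition dodecahedron (P : set vec3) : Prop :=
  similar_bodies P (conv_hull dodecahedron_vertices).

End Polyhedra.

(* Main.v *)
Require Import Defs.
From mathcomp Require Import all_boot all_order all_algebra.
From mathcomp Require Import boolp classical_sets reals.
From mathcomp Require Import ring lra.

(** In a coherent labelling every face has a single starting vertex: with the
face on the left, the labels increase from one side to the next one at every
other vertex of the face.

The cube and the dodecahedron have more vertices than faces, so some vertex is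
the starting vertex of no face. Three edges meet there, and in each of the
three faces around it the label increases from one of these edges to the
next, in the same direction around the vertex; going around it once gives a
contradiction ([not_coherently_labellable]). Their faces have at least four
extreme points, hence are not triangles ([not_simplicial]).

For the tetrahedron, the octahedron and the icosahedron a labelling is written
down, as a list of the edges in the order of their labels. What remains is to
know all faces and edges. A supporting plane meets the convex hull of a finite
set in the convex hull of the points of this set in the plane
([conv_hull_exposed]), so that a face is given by a set of vertices on which a
linear form is constant, and positive since the vertices sum to zero
([supporting_pos]). Such a set cannot contain points whose sum is zero, or is
the sum of as many vertices divided by the golden ratio: this excludes two
non-adjacent vertices of the octahedron or of the icosahedron, and all four
vertices of the tetrahedron. The sets of at least three vertices that are left
are the expected triangles ([face_triangle]).

All of this concerns standard models centred at the origin. It is carried over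
to similar bodies by [similar_coherent] and [similar_simplicial]; a similarity that
reverses the orientation reverses the order of the sides of each face, which
is compensated by changing the signs of the labels.

The vertices of the models have coordinates in Z[g], with g the golden ratio,
and in each model the sum of the vertices of a face, an edge or a vertex is an
outward normal there. Therefore all the metric facts needed are equalities and
inequalities in Z[g] between explicit elements ([face_cycles],
[triangulated]), which are decided by computation with pairs of integers and
the bounds 8/5 <= g <= 13/8. *)

Set Implicit Arguments.
Unset Strict Implicit.
Unset Printing Implicit Defensive.

Import Order.TTheory GRing.Theory Num.Theory.
Local Open Scope ring_scope.
Local Open Scope classical_set_scope.

(** * Coordinates in space *)

Section Coordinates.
Variable R : realType.
Implicit Types (u v w n a b c x : vec3 R).

(** The three coordinates of a vector. *)
Definition cx u : R := u 0 ord0.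
Definition cy u : R := u 0 (lift ord0 ord0).
Definition cz u : R := u 0 (lift ord0 (lift ord0 ord0)).

Lemma vec3P u v : cx u = cx v -> cy u = cy v -> cz u = cz v -> u = v.
Proof.
move=> ex ey ez; apply/rowP => -[[|[|[|i]]] Hi] //.
- by rewrite (_ : Ordinal Hi = ord0) //; apply: val_inj.
- by rewrite (_ : Ordinal Hi = lift ord0 ord0) //; apply: val_inj.
- by rewrite (_ : Ordinal Hi = lift ord0 (lift ord0 ord0)) //; apply: val_inj.
Qed.

Lemma cxD u v : cx (u + v) = cx u + cx v. Proof. exact: mxE. Qed.
Lemma cyD u v : cy (u + v) = cy u + cy v. Proof. exact: mxE. Qed.
Lemma czD u v : cz (u + v) = cz u + cz v. Proof. exact: mxE. Qed.
Lemma cxN u : cx (- u) = - cx u. Proof. exact: mxE. Qed.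
Lemma cyN u : cy (- u) = - cy u. Proof. exact: mxE. Qed.
Lemma czN u : cz (- u) = - cz u. Proof. exact: mxE. Qed.
Lemma cxZ k u : cx (k *: u) = k * cx u. Proof. exact: mxE. Qed.
Lemma cyZ k u : cy (k *: u) = k * cy u. Proof. exact: mxE. Qed.
Lemma czZ k u : cz (k *: u) = k * cz u. Proof. exact: mxE. Qed.
Lemma cx0 : cx 0 = 0. Proof. exact: mxE. Qed.
Lemma cy0 : cy 0 = 0. Proof. exact: mxE. Qed.
Lemma cz0 : cz 0 = 0. Proof. exact: mxE. Qed.
Lemma cx_pt (x y z : R) : cx (pt x y z) = x. Proof. by rewrite /cx mxE. Qed.
Lemma cy_pt (x y z : R) : cy (pt x y z) = y. Proof. by rewrite /cy mxE. Qed.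
Lemma cz_pt (x y z : R) : cz (pt x y z) = z. Proof. by rewrite /cz mxE. Qed.

Definition coordE := (cxD, cyD, czD, cxN, cyN, czN, cxZ, cyZ, czZ,
  cx0, cy0, cz0, cx_pt, cy_pt, cz_pt).

Lemma dotE u v : dot u v = cx u * cx v + cy u * cy v + cz u * cz v.
Proof. by rewrite /dot !big_ord_recl big_ord0 addr0 addrA. Qed.

Lemma det3E u v w : det3 u v w =
  cx u * (cy v * cz w - cz v * cy w) - cy u * (cx v * cz w - cz v * cx w)
  + cz u * (cx v * cy w - cy v * cx w).
Proof.
rewrite /det3; set A : 'M[R]_3 := (col_mx u (col_mx v w) : 'M_(1 + (1 + 1), 3)).
have e0 j : A ord0 j = u 0 j.
  rewrite -[RHS](col_mxEu u (col_mx v w) ord0 j) /A; congr (fun_of_matrix _ _ j).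
  exact: val_inj.
have e1 j : A (lift ord0 ord0) j = v 0 j.
  rewrite -[RHS](col_mxEu v w ord0 j) -[RHS](col_mxEd u (col_mx v w) _ j) /A.
  by congr (fun_of_matrix _ _ j); apply: val_inj.
have e2 j : A (lift ord0 (lift ord0 ord0)) j = w 0 j.
  rewrite -[RHS](col_mxEd v w ord0 j) -[RHS](col_mxEd u (col_mx v w) _ j) /A.
  by congr (fun_of_matrix _ _ j); apply: val_inj.
move: A e0 e1 e2 => A e0 e1 e2.
rewrite (expand_det_row A ord0) !big_ord_recl big_ord0 /cofactor.
rewrite !(expand_det_row _ ord0) !big_ord_recl !big_ord0 /cofactor !det_mx11.
rewrite !mxE !e0.
have l2 : lift (lift ord0 (lift ord0 (ord0 : 'I_1))) (ord0 : 'I_2) = ord0 :> 'I_3.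
  exact: val_inj.
have l1 : lift (lift ord0 (ord0 : 'I_2)) (ord0 : 'I_2) = ord0 :> 'I_3.
  exact: val_inj.
have l1' : lift (lift ord0 (ord0 : 'I_2)) (lift ord0 (ord0 : 'I_1))
   = lift ord0 (lift ord0 ord0) :> 'I_3 by exact: val_inj.
have l2' : lift (lift ord0 (lift ord0 (ord0 : 'I_1))) (lift ord0 (ord0 : 'I_1))
   = lift ord0 ord0 :> 'I_3 by exact: val_inj.
have m1 : lift (lift ord0 (ord0 : 'I_1)) (ord0 : 'I_1) = ord0 :> 'I_2.
  exact: val_inj.
have z1 : 0 = ord0 :> 'I_1 by exact: val_inj.
rewrite !z1 ?m1 ?l1 ?l2 ?l1' ?l2' !e1 !e2 /cx /cy /cz /= /bump /= !add0n.
rewrite !expr0 !expr1 /=.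
ring.
Qed.

Lemma dotDr n u v : dot n (u + v) = dot n u + dot n v.
Proof. by rewrite !dotE !coordE; ring. Qed.

Lemma dotZr n k u : dot n (k *: u) = k * dot n u.
Proof. by rewrite !dotE !coordE; ring. Qed.

Lemma dot0r n : dot n 0 = 0.
Proof. by rewrite dotE !coordE; ring. Qed.

Lemma dot_sumr n (I : Type) (r : seq I) (F : I -> vec3 R) :
  dot n (\sum_(i <- r) F i) = \sum_(i <- r) dot n (F i).
Proof. by rewrite (big_morph (dot n) (dotDr n) (dot0r n)). Qed.

Lemma det3_eq0 a b c n : 0 < det3 a b c ->
  dot n a = 0 -> dot n b = 0 -> dot n c = 0 -> n = 0.
Proof.
move=> D; have {D} : det3 a b c != 0 by rewrite gt_eqF.
rewrite det3E !dotE => D ha hb hc.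
apply: vec3P; rewrite !coordE; apply: (mulfI D); rewrite mulr0.
- transitivity ((cx n * cx a + cy n * cy a + cz n * cz a) * (cy b * cz c - cz b * cy c)
   + (cx n * cx b + cy n * cy b + cz n * cz b) * (cy c * cz a - cz c * cy a)
   + (cx n * cx c + cy n * cy c + cz n * cz c) * (cy a * cz b - cz a * cy b)).
    by ring.
  by rewrite ha hb hc !mul0r !addr0.
- transitivity ((cx n * cx a + cy n * cy a + cz n * cz a) * (cz b * cx c - cx b * cz c)
   + (cx n * cx b + cy n * cy b + cz n * cz b) * (cz c * cx a - cx c * cz a)
   + (cx n * cx c + cy n * cy c + cz n * cz c) * (cz a * cx b - cx a * cz b)).
    by ring.
  by rewrite ha hb hc !mul0r !addr0.
- transitivity ((cx n * cx a + cy n * cy a + cz n * cz a) * (cx b * cy c - cy b * cx c)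
   + (cx n * cx b + cy n * cy b + cz n * cz b) * (cx c * cy a - cy c * cx a)
   + (cx n * cx c + cy n * cy c + cz n * cz c) * (cx a * cy b - cy a * cx b)).
    by ring.
  by rewrite ha hb hc !mul0r !addr0.
Qed.

(** A plane that has the origin strictly below it, with respect to its normal
[n], sees a triple of its points anticlockwise as soon as the triple is
positively oriented with respect to the origin. The reason is that the
product of the determinants of (b - a, c - a, n) and of (b - a, c - a, a) is
the determinant of the matrix of their dot products. *)
Lemma det3_oriented a b c n (k : R) : 0 < k -> 0 < det3 a b c ->
  dot n a = k -> dot n b = k -> dot n c = k ->
  0 < det3 (b - a) (c - a) n.
Proof.
move=> k0 D ha hb hc.
have eD : det3 a b c = det3 (b - a) (c - a) a by rewrite !det3E !coordE; ring.
set u := b - a in eD *; set v := c - a in eD *.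
have hu : dot n u = 0 by move: ha hb; rewrite /u !dotE !coordE; lra.
have hv : dot n v = 0 by move: ha hc; rewrite /v !dotE !coordE; lra.
have H : det3 u v n * det3 u v a =
    (dot u u * dot v v - dot u v * dot u v) * dot n a
  + dot n u * (dot v u * dot v a - dot v v * dot u a)
  - dot n v * (dot u u * dot v a - dot v u * dot u a).
  by rewrite !det3E !dotE; ring.
rewrite hu hv !mul0r subr0 addr0 ha in H.
have G : dot u u * dot v v - dot u v * dot u v =
   (cy u * cz v - cz u * cy v)^+2 + (cz u * cx v - cx u * cz v)^+2
   + (cx u * cy v - cy u * cx v)^+2.
  by rewrite !dotE; ring.
have G0 : 0 <= dot u u * dot v v - dot u v * dot u v.
  by rewrite G !addr_ge0 ?sqr_ge0.
have D' : 0 < det3 u v a by rewrite -eD.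
rewrite lt_neqAle; apply/andP; split; last first.
  by rewrite -(pmulr_lge0 _ D') H mulr_ge0 // ltW.
(* equality would make the cross product of u and v vanish *)
apply/eqP => E; move: H; rewrite -E mul0r => /esym/eqP.
rewrite mulf_eq0 (gt_eqF k0) orbF G !paddr_eq0 ?addr_ge0 ?sqr_ge0 //.
rewrite !sqrf_eq0 => /andP[/andP[/eqP h1 /eqP h2] /eqP h3].
suff D0 : det3 u v a = 0 by rewrite D0 ltxx in D'.
rewrite det3E.
transitivity (cx a * (cy u * cz v - cz u * cy v) + cy a * (cz u * cx v - cx u * cz v)
   + cz a * (cx u * cy v - cy u * cx v)); first by ring.
by rewrite h1 h2 h3 !mulr0 !addr0.
Qed.

Lemma row_free2P u v :
  row_free (col_mx u v) <-> (forall s t : R, s *: u + t *: v = 0 -> s = 0 /\ t = 0).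
Proof.
split=> [fr s t e|H].
  have : row_mx s%:M t%:M *m col_mx u v = 0 *m col_mx u v.
    by rewrite mul_row_col !mul_scalar_mx mul0mx.
  move=> /(row_free_inj fr); rewrite -[RHS](@row_mx0 _ 1 1 1).
  move=> /(eq_row_mx)[/matrixP/(_ 0 0) hs /matrixP/(_ 0 0) ht].
  by move: hs ht; rewrite !mxE /= !mulr1n.
apply: inj_row_free => z; rewrite -[z]hsubmxK mul_row_col.
rewrite [lsubmx z]mx11_scalar [rsubmx z]mx11_scalar !mul_scalar_mx.
by move=> /H[-> ->]; rewrite raddf0 row_mx0.
Qed.

Lemma det3_row_free a b c : 0 < det3 a b c -> row_free (col_mx (b - a) (c - a)).
Proof.
move=> D; apply/row_free2P => s t e.
have ex : s * (cx b - cx a) + t * (cx c - cx a) = 0.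
  by move: (congr1 cx e); rewrite !coordE.
have ey : s * (cy b - cy a) + t * (cy c - cy a) = 0.
  by move: (congr1 cy e); rewrite !coordE.
have ez : s * (cz b - cz a) + t * (cz c - cz a) = 0.
  by move: (congr1 cz e); rewrite !coordE.
have {D} : det3 a b c != 0 by rewrite gt_eqF.
rewrite det3E => D.
split; apply: (mulIf D); rewrite mul0r.
- transitivity (
    (s * (cx b - cx a) + t * (cx c - cx a)) * (cy c * cz a - cz c * cy a)
    + (s * (cy b - cy a) + t * (cy c - cy a)) * (cz c * cx a - cx c * cz a)
    + (s * (cz b - cz a) + t * (cz c - cz a)) * (cx c * cy a - cy c * cx a)).
    by ring.
  by rewrite ex ey ez !mul0r !addr0.
- transitivity (
    (s * (cx b - cx a) + t * (cx c - cx a)) * (cy a * cz b - cz a * cy b)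
    + (s * (cy b - cy a) + t * (cy c - cy a)) * (cz a * cx b - cx a * cz b)
    + (s * (cz b - cz a) + t * (cz c - cz a)) * (cx a * cy b - cy a * cx b)).
    by ring.
  by rewrite ex ey ez !mul0r !addr0.
Qed.

End Coordinates.

(** * Convex hulls, segments and their faces *)

Section Hulls.
Variable R : realType.
Implicit Types (s t : seq (vec3 R)) (a b c n x : vec3 R) (F E : set (vec3 R)).

(** Weights indexed by all natural numbers, which leave the bound of the sum
free to be rewritten. *)
Lemma conv_hullP s x : conv_hull s x <-> exists w : nat -> R,
  [/\ forall i, 0 <= w i, \sum_(i < size s) w i = 1
    & x = \sum_(i < size s) w i *: s`_i].
Proof.
split=> [[w [w0 w1 ->]]|[w [w0 w1 ->]]]; last by exists (fun i => w i).
exists (fun i => if insub i is Some j then w j else 0); split.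
- by move=> i; case: insubP => // j _ _.
- by rewrite -w1; apply: eq_bigr => i _; rewrite valK.
- by apply: eq_bigr => i _; rewrite valK.
Qed.

(** A convex combination of points of a convex hull remains in it; a point of
weight zero may be anywhere. *)
Lemma conv_hull_comb (I : finType) (w : I -> R) (p : I -> vec3 R) t :
  (forall i, 0 <= w i) -> \sum_i w i = 1 ->
  (forall i, w i != 0 -> conv_hull t (p i)) ->
  conv_hull t (\sum_i w i *: p i).
Proof.
move=> w0 w1 H.
have /choice[u Hu] : forall i, exists u : 'I_(size t) -> R,
    (forall j, 0 <= u j) /\
    (w i != 0 -> \sum_j u j = 1 /\ p i = \sum_j u j *: t`_j).
  move=> i; have [_|/[dup] wi /H[u [u0 u1 e]]] := eqVneq (w i) 0.
    by exists (fun=> 0).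
  by exists u.
exists (fun j => \sum_i w i * u i j); split.
- by move=> j; apply: sumr_ge0 => i _; apply: mulr_ge0 => //; case: (Hu i).
- rewrite exchange_big -w1 /=; apply: eq_bigr => i _; rewrite -mulr_sumr.
  have [->|wi] := eqVneq (w i) 0; first by rewrite mul0r.
  by case: (Hu i) => _ /(_ wi)[-> _]; rewrite mulr1.
- under [RHS]eq_bigr do rewrite scaler_suml.
  rewrite [RHS]exchange_big /=; apply: eq_bigr => i _.
  have [->|wi] := eqVneq (w i) 0.
    by rewrite scale0r big1 // => j _; rewrite mul0r scale0r.
  case: (Hu i) => _ /(_ wi)[_ ->]; rewrite scaler_sumr.
  by apply: eq_bigr => j _; rewrite scalerA.
Qed.

Lemma mem_conv_hull s x : x \in s -> conv_hull s x.
Proof.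
rewrite -index_mem => ix; exists (fun j => (j == Ordinal ix)%:R); split.
- by move=> j; rewrite ler0n.
- by rewrite (bigD1 (Ordinal ix)) //= eqxx big1 ?addr0 // => j /negPf->.
- rewrite (bigD1 (Ordinal ix)) //= eqxx scale1r nth_index -?index_mem //.
  by rewrite big1 ?addr0 // => j /negPf->; rewrite scale0r.
Qed.

Lemma sub_conv_hull s t : {subset s <= t} -> conv_hull s `<=` conv_hull t.
Proof.
move=> st _ [w [w0 w1 ->]]; apply: conv_hull_comb => // i _.
by apply: mem_conv_hull; apply: st; apply: mem_nth.
Qed.

Lemma eq_conv_hull s t : s =i t -> conv_hull s = conv_hull t.
Proof.
by move=> st; apply/seteqP; split; apply: sub_conv_hull => v; rewrite st.
Qed.

Lemma conv_hull_le s n (c : R) x :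
  {in s, forall v, dot n v <= c} -> conv_hull s x -> dot n x <= c.
Proof.
move=> H [w [w0 w1 ->]]; rewrite dot_sumr -[c]mul1r -w1 mulr_suml.
by apply: ler_sum => i _; rewrite dotZr ler_wpM2l // H // mem_nth.
Qed.

Lemma conv_hull_eq s n (c : R) x :
  {in s, forall v, dot n v = c} -> conv_hull s x -> dot n x = c.
Proof.
move=> H [w [w0 w1 ->]]; rewrite dot_sumr -[c]mul1r -w1 mulr_suml.
by apply: eq_bigr => i _; rewrite dotZr H // mem_nth.
Qed.

Lemma det3_conv_hull s u a n x : {in s, forall y, 0 <= det3 u (y - a) n} ->
  conv_hull s x -> 0 <= det3 u (x - a) n.
Proof.
(* the determinant is an affine function of x *)
pose m := pt (cz n * cy u - cy n * cz u) (cx n * cz u - cz n * cx u)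
  (cy n * cx u - cx n * cy u).
have e y : det3 u (y - a) n = dot m a - dot m y.
  by rewrite det3E !dotE !coordE; ring.
move=> H sx; rewrite e subr_ge0; apply: conv_hull_le sx => y /H.
by rewrite e subr_ge0.
Qed.

Lemma conv_hull_exposed s n (c : R) : {in s, forall v, dot n v <= c} ->
  conv_hull s `&` [set x | dot n x = c] = conv_hull [seq v <- s | dot n v == c].
Proof.
move=> H; apply/seteqP; split=> [x [[w [w0 w1 ->]]]|x hx]; last first.
  split; first by apply: sub_conv_hull hx => v; rewrite mem_filter => /andP[].
  by apply: conv_hull_eq hx => v; rewrite mem_filter => /andP[/eqP].
rewrite /= dot_sumr => e; apply: conv_hull_comb => // i wi.
apply: mem_conv_hull; rewrite mem_filter mem_nth // andbT.
(* the weighted sum of the nonnegative defects c - n.v vanishes *)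
have K : \sum_i0 w i0 * (c - dot n s`_i0) = 0.
  under eq_bigr do rewrite mulrBr -dotZr.
  by rewrite sumrB e -mulr_suml w1 mul1r subrr.
have /psumr_eq0P/(_ K)/(_ i isT) : forall j, true -> 0 <= w j * (c - dot n s`_j).
  by move=> j _; rewrite mulr_ge0 // subr_ge0 H // mem_nth.
by move=> /eqP; rewrite mulf_eq0 (negPf wi) subr_eq0 eq_sym.
Qed.

Lemma conv_hull_face s n F : supporting (conv_hull s) n F ->
  exists c : R, {in s, forall v, dot n v <= c}
    /\ F = conv_hull [seq v <- s | dot n v == c].
Proof.
move=> [_ [c H ->]]; have K : {in s, forall v, dot n v <= c}.
  by move=> v /mem_conv_hull/H.
by exists c; split; rewrite ?conv_hull_exposed.
Qed.

Lemma supporting_conv_hull s n (c : R) : n != 0 ->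
  {in s, forall v, dot n v <= c} ->
  supporting (conv_hull s) n (conv_hull [seq v <- s | dot n v == c]).
Proof.
move=> n0 H; split=> //; exists c; first by move=> x; apply: conv_hull_le.
by rewrite conv_hull_exposed.
Qed.

Lemma segmentP a b x : segment a b x <->
  exists2 t : R, 0 <= t <= 1 & x = a + t *: (b - a).
Proof.
split=> [[w []]|[t /andP[t0 t1] ->]].
  rewrite !big_ord_recl !big_ord0 !addr0 /= => w0 w1 ->.
  exists (w (lift ord0 ord0)).
    by rewrite w0 /= -w1 lerDr.
  rewrite scalerBr addrCA -[X in _ + (X - _)]scale1r -scalerBl -w1 addrK.
  by rewrite addrC.
apply/conv_hullP; exists (fun i => if i is 0%N then 1 - t else if i is 1%N then t else 0).
split; first by case=> [|[|]] //; rewrite subr_ge0.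
  by rewrite !big_ord_recl big_ord0 /=; lra.
by apply: vec3P; rewrite !big_ord_recl big_ord0 /= !coordE; ring.
Qed.

Lemma segmentl a b : segment a b a.
Proof. by apply: mem_conv_hull; rewrite inE eqxx. Qed.

Lemma segmentr a b : segment a b b.
Proof. by apply: mem_conv_hull; rewrite !inE eqxx orbT. Qed.

Lemma segmentC a b : segment a b = segment b a.
Proof. by apply: eq_conv_hull => x; rewrite !inE orbC. Qed.

Lemma conv_hull1 a x : conv_hull [:: a] x -> x = a.
Proof.
by move=> [w [_]]; rewrite !big_ord_recl !big_ord0 !addr0 => -> ->; rewrite scale1r.
Qed.

Lemma conv_hull0 x : ~ conv_hull [::] x.
Proof.
by move=> [w [_]]; rewrite big_ord0 => /eqP; rewrite eq_sym oner_eq0.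
Qed.

(** A segment determines its endpoints. *)
Lemma segment_inj a b c d : a != b -> segment a b = segment c d ->
  (a, b) = (c, d) \/ (a, b) = (d, c).
Proof.
move=> ab e.
have /segmentP[s s01 ea] : segment c d a by rewrite -e; apply: segmentl.
have /segmentP[t t01 eb] : segment c d b by rewrite -e; apply: segmentr.
have /segmentP[s' s'01 ec] : segment a b c by rewrite e; apply: segmentl.
have /segmentP[t' t'01 ed] : segment a b d by rewrite e; apply: segmentr.
have f0 : d - c != 0.
  apply: contra ab => /eqP h.
  by rewrite ea eb h !scaler0.
have eba : b - a = (t - s) *: (d - c).
  by rewrite ea eb opprD addrACA subrr add0r -scalerBl.
have hs : s + s' * (t - s) = 0.
  apply/eqP; move: ec; rewrite eba scalerA ea -addrA -scalerDl.
  move=> /esym/eqP; rewrite -subr_eq0 addrAC subrr add0r scaler_eq0.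
  by rewrite (negPf f0) orbF.
have ht : s + t' * (t - s) = 1.
  apply/eqP; rewrite -subr_eq0; move: ed; rewrite eba scalerA ea -addrA -scalerDl.
  rewrite -{1}(subrK c d) [LHS]addrC => /addrI/eqP.
  rewrite eq_sym -subr_eq0 -{2}[d - c]scale1r -scalerBl scaler_eq0.
  by rewrite (negPf f0) orbF.
move: s01 t01 s'01 t'01 => /andP[s0 s1] /andP[t0 t1] /andP[s'0 s'1] /andP[t'0 t'1].
have [st|/ltW st] := leP s t.
  have ts : 0 <= t - s by rewrite subr_ge0.
  have h1 : 0 <= s' * (t - s) by rewrite mulr_ge0.
  have h2 : 0 <= (1 - t') * (t - s) by rewrite mulr_ge0 // subr_ge0.
  have s00 : s = 0 by clear -hs h1 s0; lra.
  have t11 : t = 1 by clear -ht h2 t1; lra.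
  by left; rewrite ea eb s00 t11 scale0r scale1r addr0 addrC subrK.
have ts : 0 <= s - t by rewrite subr_ge0.
have h1 : 0 <= t' * (s - t) by rewrite mulr_ge0.
have h2 : 0 <= (1 - s') * (s - t) by rewrite mulr_ge0 // subr_ge0.
have s11 : s = 1 by clear -ht h1 s1; lra.
have t00 : t = 0 by clear -hs h2 t0; lra.
by right; rewrite ea eb s11 t00 scale0r scale1r addr0 addrC subrK.
Qed.

Lemma segment_collinear a b : ~ noncollinear (segment a b).
Proof.
move=> [p [q [r []]]] /segmentP[s _ ->] /segmentP[t _ ->] /segmentP[u _ ->].
have K (x y : vec3 R) : a + x - (a + y) = x - y.
  by rewrite opprD addrACA subrr add0r.
rewrite !K -!scalerBl => /row_free2P fr.
have [|us /eqP] := fr (u - s) (- (t - s)).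
  by rewrite !scalerA -scalerDl mulrC mulNr subrr scale0r.
rewrite oppr_eq0 => /eqP ts.
have [] := fr 1 0; first by rewrite ts !scale0r scaler0 addr0.
by move=> /eqP; rewrite oner_eq0.
Qed.

Lemma sub_noncollinear F E : F `<=` E -> noncollinear F -> noncollinear E.
Proof.
by move=> FE [a [b [c [/FE ? /FE ? /FE ? ?]]]]; exists a, b, c.
Qed.

Lemma noncollinear_size s : noncollinear (conv_hull s) -> (2 < size s)%N.
Proof.
case: s => [|a [|b [|c s]]] // H; exfalso.
- by case: H => x [? [? []]] /conv_hull0.
- apply: (@segment_collinear a a); apply: sub_noncollinear H.
  by apply: sub_conv_hull => v; rewrite !inE orbb.
- exact: segment_collinear H.
Qed.

End Hulls.

(** * Similarities *)

Lemma image_cancel (T U : Type) (f : T -> U) (g : U -> T) (A : set T) :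
  cancel f g -> g @` (f @` A) = A.
Proof.
move=> fK; apply/seteqP; split=> [_ [_ [x Ax <-] <-]|x Ax]; first by rewrite fK.
by exists (f x); [exact: imageP|exact: fK].
Qed.

Lemma map_sides (T U : Type) (f : T -> U) (v : seq T) :
  zip (map f v) (rot 1 (map f v)) = [seq (f p.1, f p.2) | p <- zip v (rot 1 v)].
Proof. by rewrite -map_rot; elim: v (rot 1 v) => [|x v IH] [|y w] //=; rewrite IH. Qed.

(** Reading the closed polygon [v] backwards, from the end of its first side,
lists its sides reversed and in the opposite order. *)
Lemma rev_sides (T : Type) (v : seq T) (w := rev (rot 1 v)) :
  zip w (rot 1 w) = rev [seq (p.2, p.1) | p <- zip v (rot 1 v)].
Proof.
have e : rot 1 w = rev v.
  by rewrite /w -[in RHS](rotK 1 v) rev_rotr.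
rewrite e /w -rev_zip ?size_rot //; congr rev.
by elim: v (rot 1 v) {w e} => [|x v IH] [|y w] //=; rewrite IH.
Qed.

Section Similarities.
Variable R : realType.
Implicit Types (P F E : set (vec3 R)) (n x t : vec3 R) (O : 'M[R]_3) (k : R).

(** The similarity of ratio [k], linear part [k *: O] and value [t] at 0. *)
Definition sim k O t x : vec3 R := k *: (x *m O) + t.

Lemma simB k O t x y : sim k O t x - sim k O t y = k *: ((x - y) *m O).
Proof. by rewrite /sim opprD addrACA subrr addr0 -scalerBr -mulmxBl. Qed.

Lemma sim_conv_hull k O t (s : seq (vec3 R)) :
  sim k O t @` conv_hull s = conv_hull (map (sim k O t) s).
Proof.
have H (w : nat -> R) : \sum_(i < size s) w i = 1 ->
    sim k O t (\sum_(i < size s) w i *: s`_i) =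
    \sum_(i < size s) w i *: (map (sim k O t) s)`_i.
  move=> w1; rewrite /sim mulmx_suml scaler_sumr -[in LHS](scale1r t) -w1.
  rewrite scaler_suml -big_split /=; apply: eq_bigr => i _.
  by rewrite (nth_map 0) // -scalemxAl scalerDr !scalerA mulrC.
apply/seteqP; split=> [_ [x /conv_hullP[w [w0 w1 ->]] <-]|].
  by apply/conv_hullP; exists w; rewrite size_map H.
move=> x /conv_hullP[w []]; rewrite size_map => w0 w1 ->; rewrite -H //.
by apply: imageP; apply/conv_hullP; exists w.
Qed.

Lemma sim_segment k O t a b :
  sim k O t @` segment a b = segment (sim k O t a) (sim k O t b).
Proof. exact: sim_conv_hull. Qed.

Lemma dot_mul O u v : O *m O^T = 1%:M -> dot (u *m O) (v *m O) = dot u v.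
Proof.
have e (x y : vec3 R) : dot x y = (x *m y^T) 0 0.
  by rewrite mxE; apply: eq_bigr => i _; rewrite mxE.
by move=> OO; rewrite !e trmx_mul mulmxA -(mulmxA u) OO mulmx1.
Qed.

Lemma det3_mul O u v w :
  det3 (u *m O) (v *m O) (w *m O) = det3 u v w * \det O.
Proof. by rewrite /det3 -!mul_col_mx det_mulmx. Qed.

Lemma det_orth O : O *m O^T = 1%:M -> \det O = 1 \/ \det O = -1.
Proof.
move=> /(congr1 (fun A : 'M[R]_3 => \det A)); rewrite det_mulmx det_tr det1.
move=> /eqP; rewrite -expr2 -subr_eq0 subr_sqr_1 mulf_eq0 subr_eq0 addr_eq0.
by case/orP => /eqP; [left|right].
Qed.

Lemma sim_inverse k O t : 0 < k -> O *m O^T = 1%:M ->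
  exists k' t', [/\ 0 < k', cancel (sim k O t) (sim k' O^T t')
                  & cancel (sim k' O^T t') (sim k O t)].
Proof.
move=> k0 OO; have OO' := mulmx1C OO.
exists k^-1, (- (k^-1 *: (t *m O^T))); split; first by rewrite invr_gt0.
- move=> x; rewrite /sim mulmxDl scalerDr addrK -scalemxAl scalerA mulVf ?gt_eqF //.
  by rewrite scale1r -mulmxA OO mulmx1.
- move=> x; rewrite /sim mulmxDl mulNmx -!scalemxAl -!mulmxA OO' !mulmx1.
  by rewrite scalerDr scalerN !scalerA divff ?gt_eqF // !scale1r subrK.
Qed.

Lemma similar_bodies_sym P (Q : set (vec3 R)) :
  similar_bodies P Q -> similar_bodies Q P.
Proof.
move=> [k [O [t [k0 OO ->]]]].
have [k' [t' [k'0 fK gK]]] := sim_inverse t k0 OO.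
exists k', O^T, t'; split=> //; first by rewrite trmxK (mulmx1C OO).
rewrite [RHS](_ : _ = sim k' O^T t' @` (sim k O t @` Q)) //.
by rewrite image_cancel.
Qed.

Section Transfer.
Variables (k : R) (O : 'M[R]_3) (t : vec3 R).
Hypotheses (k0 : 0 < k) (OO : O *m O^T = 1%:M).
Local Notation f := (sim k O t).

Lemma sim_inj : injective f.
Proof. by have [k' [t' [_ /can_inj]]] := sim_inverse t k0 OO. Qed.

Lemma supporting_sim P n F : supporting P n F -> supporting (f @` P) (n *m O) (f @` F).
Proof.
move=> [n0 [c Pc ->]]; split.
  by apply: contra n0 => /eqP h; rewrite -[n]mulmx1 -OO mulmxA h mul0mx.
have e x : dot (n *m O) (f x) = k * dot n x + dot (n *m O) t.
  by rewrite /sim dotDr dotZr dot_mul.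
exists (k * c + dot (n *m O) t).
  by move=> _ [x Px <-]; rewrite e lerD2r ler_pM2l // Pc.
apply/seteqP; split=> [_ [x [Px /= xc] <-]|_ [[x Px <-] /=]].
  by split; [exact: imageP|rewrite /= e xc].
move=> /eqP; rewrite e (inj_eq (addIr _)) => /eqP/(mulfI _) xc.
by exists x => //; split=> //=; apply: xc; rewrite gt_eqF.
Qed.

Lemma noncollinear_sim F : noncollinear F -> noncollinear (f @` F).
Proof.
move=> [a [b [c [Fa Fb Fc fr]]]]; exists (f a), (f b), (f c); split; try exact: imageP.
apply/row_free2P => r s; rewrite !simB !scalerA ![_ * k]mulrC -!scalerA -scalerDr.
move=> /eqP; rewrite scaler_eq0 gt_eqF //= !scalemxAl -mulmxDl => /eqP h.
move/row_free2P: fr; apply.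
by rewrite -[LHS]mulmx1 -OO mulmxA h mul0mx.
Qed.

Lemma face_sim P n F : face P n F -> face (f @` P) (n *m O) (f @` F).
Proof. by move=> [/supporting_sim ? /noncollinear_sim]. Qed.

Lemma edge_sim P E : edge P E -> edge (f @` P) (f @` E).
Proof.
move=> [[n /supporting_sim PE] [a [b [ab E_]]]]; split; first by exists (n *m O).
by exists (f a), (f b); rewrite (inj_eq sim_inj) E_ sim_segment.
Qed.

End Transfer.

(** The image of an anticlockwise listing [v] of the vertices of a face under a
similarity, read backwards if the similarity reverses the orientation. *)
Definition sim_listing k O t (v : seq (vec3 R)) : seq (vec3 R) :=
  map (sim k O t) (if \det O == 1 then v else rev (rot 1 v)).

Lemma sides_sim_listing k O t v (f := sim k O t) :
  sides (sim_listing k O t v) =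
  if \det O == 1 then [seq (f p.1, f p.2) | p <- sides v]
  else rev [seq (f p.2, f p.1) | p <- sides v].
Proof.
rewrite /sides /sim_listing map_sides; case: ifP => // _.
by rewrite rev_sides map_rev -map_comp.
Qed.

Lemma anticlockwise_sim k O t P n F v : 0 < k -> O *m O^T = 1%:M ->
  anticlockwise P n F v ->
  anticlockwise (sim k O t @` P) (n *m O) (sim k O t @` F) (sim_listing k O t v).
Proof.
move=> k0 OO; have [k' [t' [k'0 fK gK]]] := sim_inverse t k0 OO.
have OO' : O^T *m O^T^T = 1%:M by rewrite trmxK (mulmx1C OO).
set f := sim k O t; set g := sim k' O^T t' in fK gK.
have fgK E : f @` (g @` E) = E by exact: image_cancel.
have gfK E : g @` (f @` E) = E by exact: image_cancel.
move=> [uv vE vD]; split.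
- rewrite map_inj_uniq; last exact: can_inj fK.
  by case: ifP; rewrite ?rev_uniq ?rot_uniq.
- move=> E; split=> [[PE EF]|].
    have [|p pv Ep] := (vE (g @` E)).1.
      split; first by rewrite -[P]gfK; apply: edge_sim.
      by rewrite -[F]gfK; apply: image_subset.
    rewrite sides_sim_listing -[E]fgK Ep sim_segment; case: ifP => _.
      by exists (f p.1, f p.2) => //; apply/mapP; exists p.
    exists (f p.2, f p.1); last exact: segmentC.
    by rewrite mem_rev; apply/mapP; exists p.
  rewrite sides_sim_listing => -[q qv Eq].
  have [p pv Ep] : exists2 p, p \in sides v & E = f @` segment p.1 p.2.
    case: ifP qv => _; rewrite ?mem_rev => /mapP[p pv qp]; exists p => //.
      by rewrite sim_segment Eq qp.
    by rewrite sim_segment Eq qp segmentC.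
  have [|Pp Fp] := (vE (segment p.1 p.2)).2; first by exists p.
  by rewrite Ep; split; [exact: edge_sim|exact: image_subset].
- move=> q _ qv [x Fx <-].
  have D (p x' : vec3 R) y : det3 (f p - f x') (f y - f x') (n *m O) =
      k ^+ 2 * (det3 (p - x') (y - x') n * \det O).
    by rewrite !simB -det3_mul !det3E !coordE; ring.
  move: qv; rewrite sides_sim_listing; case: ifP => [/eqP dO|dO].
    move=> /mapP[p pv ->]; rewrite D dO mulr1 mulr_ge0 ?sqr_ge0 //.
    exact: vD.
  have {}dO : \det O = -1 by case: (det_orth OO) dO => [->|//]; rewrite eqxx.
  rewrite mem_rev => /mapP[p pv ->]; rewrite D dO mulr_ge0 ?sqr_ge0 //.
  have -> : det3 (p.1 - p.2) (x - p.2) n * -1 = det3 (p.2 - p.1) (x - p.1) n.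
    by rewrite !det3E !coordE; ring.
  exact: vD.
Qed.

Lemma similar_coherent P (Q : set (vec3 R)) :
  similar_bodies P Q -> coherently_labellable Q -> coherently_labellable P.
Proof.
move=> [k [O [t [k0 OO ->]]]] [lab labP].
have [k' [t' [k'0 fK gK]]] := sim_inverse t k0 OO.
have OO' : O^T *m O^T^T = 1%:M by rewrite trmxK (mulmx1C OO).
rewrite [X in coherently_labellable X](_ : _ = sim k O t @` Q) //.
set f := sim k O t in fK gK *; set g := sim k' O^T t' in fK gK.
have fgK E : f @` (g @` E) = E by exact: image_cancel.
have gfK E : g @` (f @` E) = E by exact: image_cancel.
(* a reflection turns the anticlockwise order around, hence the sign *)
exists (fun E => (if \det O == 1 then lab (g @` E) else - lab (g @` E))).
move=> n F PF.
have [|v [vF vs]] := labP (n *m O^T) (g @` F).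
  by rewrite -[Q]gfK; apply: face_sim.
exists (sim_listing k O t v); split.
  have := anticlockwise_sim t k0 OO vF.
  by rewrite fgK -mulmxA (mulmx1C OO) mulmx1.
rewrite sides_sim_listing; case: ifP => _.
  rewrite -map_comp (eq_map (g := fun p => lab (segment p.1 p.2))) //.
  by move=> p /=; rewrite -sim_segment gfK.
rewrite map_rev -map_comp rev_sorted.
rewrite (eq_map (g := fun p => - lab (segment p.1 p.2))); last first.
  by move=> p /=; rewrite segmentC -sim_segment gfK.
move: vs; rewrite !sorted_map; apply: sub_sorted => p q /=.
by rewrite ltrN2.
Qed.

Lemma similar_simplicial P (Q : set (vec3 R)) :
  similar_bodies P Q -> simplicial Q -> simplicial P.
Proof.
move=> [k [O [t [k0 OO ->]]]] sQ.
have [k' [t' [k'0 fK gK]]] := sim_inverse t k0 OO.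
have OO' : O^T *m O^T^T = 1%:M by rewrite trmxK (mulmx1C OO).
rewrite [X in simplicial X](_ : _ = sim k O t @` Q) //.
set f := sim k O t in fK gK *; set g := sim k' O^T t' in fK gK.
have fgK E : f @` (g @` E) = E by exact: image_cancel.
have gfK E : g @` (f @` E) = E by exact: image_cancel.
move=> n F PF; have [|a [b [c Fabc]]] := sQ (n *m O^T) (g @` F).
  by rewrite -[Q]gfK; apply: face_sim.
by exists (f a), (f b), (f c); rewrite -[F]fgK Fabc sim_conv_hull.
Qed.

End Similarities.

(** * Exact arithmetic in the ring of integers of the golden field *)

(** The pair (a, b) stands for a + b g, where g is the golden ratio. *)
Definition zphi : Type := (int * int)%type.
Definition zadd (y z : zphi) : zphi := (y.1 + z.1, y.2 + z.2).
Definition zsub (y z : zphi) : zphi := (y.1 - z.1, y.2 - z.2).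
Definition zmul (y z : zphi) : zphi :=
  (y.1 * z.1 + y.2 * z.2, y.1 * z.2 + y.2 * z.1 + y.2 * z.2).

(** A sufficient condition for positivity, from the bounds 8/5 and 13/8 of the
golden ratio. *)
Definition zpos (z : zphi) : bool :=
  0 < (if 0 <= z.2 then 5 * z.1 + 8 * z.2 else 8 * z.1 + 13 * z.2).

Definition zvec : Type := (zphi * zphi * zphi)%type.
Definition zvec0 : zvec := ((0, 0), (0, 0), (0, 0)).
Definition zvadd (u v : zvec) : zvec :=
  (zadd u.1.1 v.1.1, zadd u.1.2 v.1.2, zadd u.2 v.2).
Definition zvscale (k : zphi) (u : zvec) : zvec :=
  (zmul k u.1.1, zmul k u.1.2, zmul k u.2).
Definition zdot (u v : zvec) : zphi :=
  zadd (zadd (zmul u.1.1 v.1.1) (zmul u.1.2 v.1.2)) (zmul u.2 v.2).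
Definition zcross (u v : zvec) : zvec :=
  (zsub (zmul u.1.2 v.2) (zmul u.2 v.1.2),
   zsub (zmul u.2 v.1.1) (zmul u.1.1 v.2),
   zsub (zmul u.1.1 v.1.2) (zmul u.1.2 v.1.1)).
Definition zdet (u v w : zvec) : zphi := zdot u (zcross v w).

Section Evaluation.
Variable R : realType.
Implicit Types (y z : zphi) (u v w : zvec).
Local Notation g := (golden R).

Lemma golden_sqr : g * g = g + 1.
Proof.
have : Num.sqrt 5 ^+ 2 = 5 :> R by rewrite sqr_sqrtr.
rewrite /golden expr2; set s := Num.sqrt 5 => h.
have -> : (1 + s) / 2 * ((1 + s) / 2) = (1 + 2 * s + s * s) / 4 by field.
by rewrite h; field.
Qed.

Lemma golden_bounds : 8 / 5 <= g <= 13 / 8.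
Proof.
have h : Num.sqrt 5 ^+ 2 = 5 :> R by rewrite sqr_sqrtr.
have := sqrtr_ge0 (5 : R); rewrite /golden; move: h; set s := Num.sqrt 5 => h s0.
have s1 : 11 / 5 <= s.
  by rewrite -(ler_pXn2r (n := 2)) ?nnegrE //; lra.
have s2 : s <= 9 / 4.
  by rewrite -(ler_pXn2r (n := 2)) ?nnegrE //; lra.
by apply/andP; split; lra.
Qed.

Lemma golden_gt1 : 1 < g.
Proof. by have /andP[] := golden_bounds; lra. Qed.

Lemma golden_inv : g^-1 = g - 1.
Proof.
have g0 : g != 0 by rewrite gt_eqF // (lt_trans _ golden_gt1).
by apply: (mulfI g0); rewrite mulfV // mulrBr golden_sqr mulr1 addrAC subrr add0r.
Qed.

(** The values in [R] of an element of Z[g] and of a vector over Z[g]. *)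
Definition ev z : R := z.1%:~R + z.2%:~R * g.
Definition evv u : vec3 R := pt (ev u.1.1) (ev u.1.2) (ev u.2).

Lemma evD y z : ev (zadd y z) = ev y + ev z.
Proof. by rewrite /ev /= !rmorphD /=; ring. Qed.

Lemma evB y z : ev (zsub y z) = ev y - ev z.
Proof. by rewrite /ev /= !rmorphB /=; ring. Qed.

Lemma evM y z : ev (zmul y z) = ev y * ev z.
Proof.
rewrite /ev /= !rmorphD !rmorphM /=.
transitivity (y.1%:~R * z.1%:~R + (y.1%:~R * z.2%:~R + y.2%:~R * z.1%:~R) * g
  + y.2%:~R * z.2%:~R * (g * g)); last by ring.
by rewrite golden_sqr; ring.
Qed.

Lemma zpos_gt0 z : zpos z -> 0 < ev z.
Proof.
case: z => a b; rewrite /zpos /ev /=; have /andP[g1 g2] := golden_bounds.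
case: (leP 0 b) => b0; rewrite -(ltr0z R) rmorphD !rmorphM /= => h.
  have {}b0 : 0 <= b%:~R :> R by rewrite ler0z.
  by have := ler_wpM2l b0 g1; lra.
have {}b0 : b%:~R <= 0 :> R by rewrite lerz0 ltW.
by have := ler_wnM2l b0 g2; lra.
Qed.

Lemma evv0 : evv zvec0 = 0.
Proof. by apply: vec3P; rewrite !coordE /ev /=; ring. Qed.

Lemma evvD u v : evv (zvadd u v) = evv u + evv v.
Proof. by apply: vec3P; rewrite !coordE /= evD. Qed.

Lemma evvZ z u : evv (zvscale z u) = ev z *: evv u.
Proof. by apply: vec3P; rewrite !coordE /= evM. Qed.

Lemma evv_dot u v : ev (zdot u v) = dot (evv u) (evv v).
Proof. by rewrite dotE !coordE !evD !evM. Qed.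

Lemma evv_det u v w : ev (zdet u v w) = det3 (evv u) (evv v) (evv w).
Proof. by rewrite det3E !coordE !evD !evM !evB !evM; ring. Qed.

End Evaluation.

(** * Combinatorial certificates *)

(** All the subsequences of [s]. *)
Fixpoint subseqs (T : Type) (s : seq T) : seq (seq T) :=
  if s is x :: s' then map (cons x) (subseqs s') ++ subseqs s' else [:: [::]].

Lemma filter_subseqs (T : eqType) (p : pred T) (s : seq T) :
  filter p s \in subseqs s.
Proof.
elim: s => [|x s IH] /=; first by rewrite inE.
by rewrite mem_cat; case: ifP => _; rewrite ?IH ?orbT // map_f.
Qed.

Section Certificates.
Variable V : seq zvec.
Implicit Types (i j : nat) (W f : seq nat) (Fs : seq (seq nat)).

(** The vertex of index [i]. *)
Definition vtx i : zvec := nth zvec0 V i.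

(** The sum of the vertices indexed by [W], with repetitions. *)
Definition vsum W : zvec := foldr (fun i => zvadd (vtx i)) zvec0 W.

(** The dot product with the sum of the vertices indexed by [W] takes its maximum
over all vertices exactly at those, and this maximum is positive. In a platonic solid centred at the
origin this holds for the vertex set of every vertex, edge and face. *)
Definition exposed W : bool :=
  let m := vsum W in let c := zdot m (vtx (head 0%N W)) in
  [&& W != [::], all (fun i => i < size V)%N W, zpos c &
  all (fun j => if j \in W then zdot m (vtx j) == c
                else zpos (zsub c (zdot m (vtx j)))) (iota 0 (size V))].

(** Every cycle of [Fs] is a face, its consecutive vertices span edges and turn
anticlockwise, as seen from outside. *)
Definition face_cycles Fs : bool :=
  [&& all (fun i => exposed [:: i]) (iota 0 (size V)), all exposed Fs,
      all uniq Fs &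
      all (fun f => all (fun i => exposed [:: i; next f i] &&
        zpos (zdet (vtx (prev f i)) (vtx i) (vtx (next f i)))) f) Fs].

(** Three of the faces meet at [i] and follow each other around it. *)
Definition cubic_vertex Fs i : bool :=
  has (fun f1 => has (fun f2 => has (fun f3 =>
    [&& i \in f1, i \in f2, i \in f3, next f1 i == prev f2 i,
        next f2 i == prev f3 i & next f3 i == prev f1 i]) Fs) Fs) Fs.

(** A pair (B, B') such that the sum of the vertices in [B] is, up to the factor
g > 1, the sum of at most as many vertices. No face can contain [B]. *)
Definition blocker (BB : seq nat * seq nat) : bool :=
  [&& (0 < size BB.1)%N, (size BB.2 <= size BB.1)%N,
      all (fun i => i < size V)%N BB.2
      & zvscale (0, 1) (vsum BB.1) == vsum BB.2].

(** The cycles [Fs] are triangles, and every set of at least three vertices is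
one of them or contains some [B] with (B, B') in [Bs]; hence [Fs] lists all
the faces. *)
Definition triangulated Fs (Bs : seq (seq nat * seq nat)) : bool :=
  [&& (0 < size Fs)%N, all (fun f => size f == 3%N) Fs,
      vsum (iota 0 (size V)) == zvec0, all blocker Bs &
      all (fun I => [|| (size I <= 2)%N,
                        has (fun f => (size I == size f) && all (mem f) I) Fs
                      | has (fun BB => all (mem I) BB.1) Bs])
          (subseqs (iota 0 (size V)))].

(** The label of an edge is its position in the list [L]. *)
Definition edge_label (L : seq (nat * nat)) (p : nat * nat) : nat :=
  find (fun e => (e == p) || (e == (p.2, p.1))) L.

(** The sides of each face have increasing labels when they are read from the
first element of its cycle. *)
Definition sorted_labels Fs (L : seq (nat * nat)) : bool :=
  all (fun e => (e.1 < size V) && (e.2 < size V))%N L &&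
  all (fun f => sorted ltn (map (edge_label L) (zip f (rot 1 f)))) Fs.

Variable R : realType.
Local Notation pos i := (evv R (vtx i)).
Local Notation body := (conv_hull (map (evv R) V)).

Lemma evv_vsum W : evv R (vsum W) = \sum_(i <- W) pos i.
Proof.
by elim: W => [|i W IH]; rewrite ?big_nil ?evv0 // big_cons /= evvD IH.
Qed.

Lemma vertexP v : reflect (exists2 i, (i < size V)%N & v = pos i)
  (v \in map (evv R) V).
Proof.
apply: (iffP (nthP 0)) => [[i]|[i iV ->]]; rewrite ?size_map.
  by move=> iV <-; exists i => //; rewrite (nth_map zvec0).
by exists i; rewrite ?size_map // (nth_map zvec0).
Qed.

Lemma exposedP W : exposed W -> exists c : R,
  [/\ 0 < c, {in map (evv R) V, forall v, dot (evv R (vsum W)) v <= c},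
      forall j, (j < size V)%N -> (dot (evv R (vsum W)) (pos j) == c) = (j \in W)
    & supporting body (evv R (vsum W)) (conv_hull [seq pos i | i <- W])].
Proof.
case/and4P=> W0 WV c0 /allP H; set n := evv R (vsum W).
exists (ev R (zdot (vsum W) (vtx (head 0%N W)))).
set c := ev R _; have {}c0 : 0 < c by exact: zpos_gt0.
have H1 j : (j < size V)%N -> (dot n (pos j) <= c) /\ (dot n (pos j) == c) = (j \in W).
  move=> jV; have := H j; rewrite mem_iota add0n jV => /(_ isT).
  rewrite -evv_dot; case: ifP => _; first by move=> /eqP->; rewrite eqxx.
  by move/(zpos_gt0 R); rewrite evB subr_gt0 => h; rewrite ltW // lt_eqF.
have le : {in map (evv R) V, forall v, dot n v <= c}.
  by move=> _ /vertexP[j /H1[]? _ ->].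
split=> //; first by move=> j /H1[].
have n0 : n != 0.
  apply/eqP => n0; move: c0; rewrite /c evv_dot -/n n0.
  by rewrite dotE !coordE !mul0r !addr0 ltxx.
rewrite (_ : conv_hull [seq pos i | i <- W] =
  conv_hull [seq v <- map (evv R) V | dot n v == c]).
  exact: supporting_conv_hull.
apply: eq_conv_hull => v; rewrite mem_filter; apply/mapP/andP.
  move=> [j jW ->]; have jV := allP WV j jW.
  by have [_ ->] := H1 j jV; split=> //; apply/vertexP; exists j.
by move=> [nv /vertexP[j jV vj]]; exists j => //; have [_ <-] := H1 j jV; rewrite -vj.
Qed.

End Certificates.

(** * Solids with fewer faces than vertices *)

Section Obstruction.
Variable R : realType.
Implicit Types (P F : set (vec3 R)) (a b c n x : vec3 R).

(** In a cyclic listing [v] whose successive sides have increasing values, only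
at the first vertex of [v] can the value fail to increase. *)
Lemma sorted_sides (T : eqType) (lab : T * T -> int) (v : seq T) (x0 a x b : T) :
  uniq v -> sorted <%R [seq lab p | p <- zip v (rot 1 v)] ->
  (a, x) \in zip v (rot 1 v) -> (x, b) \in zip v (rot 1 v) -> x != head x0 v ->
  lab (a, x) < lab (x, b).
Proof.
case: v => // y w; rewrite rot1_cons; set z := zip _ _ => uv sz ax xb xy.
have sizez : size z = (size w).+1 by rewrite size_zip size_rcons minnn.
have nthz i : nth (x0, x0) z i = (nth x0 (y :: w) i, nth x0 (rcons w y) i).
  by rewrite nth_zip // size_rcons.
have iz := ax; rewrite -index_mem in iz; set i := index _ z in iz.
have jz := xb; rewrite -index_mem in jz; set j := index _ z in jz.
have [ai xi] : a = nth x0 (y :: w) i /\ x = nth x0 (rcons w y) i.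
  by have := nth_index (x0, x0) ax; rewrite -/i nthz => -[-> ->].
have [xj bj] : x = nth x0 (y :: w) j /\ b = nth x0 (rcons w y) j.
  by have := nth_index (x0, x0) xb; rewrite -/j nthz => -[-> ->].
have iw : (i < size w)%N.
  move: iz; rewrite sizez ltnS leq_eqVlt => /orP[/eqP iw|//].
  by move: xy; rewrite xi nth_rcons iw ltnn eqxx /= eqxx.
have ji : j = i.+1.
  have jw : (j < size (y :: w))%N by rewrite /= -sizez.
  apply/eqP; rewrite -(nth_uniq x0 jw (iw : i.+1 < size (y :: w))%N uv) /=.
  by rewrite -xj xi nth_rcons iw.
have := sorted_ltn_nth lt_trans (lab (x0, x0)) sz.
move=> /(_ i j); rewrite !inE !size_map => /(_ iz jz).
by rewrite {1}ji leqnn => /(_ isT); rewrite !(nth_map (x0, x0)) // !nth_index.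
Qed.

Lemma segment_neq a x b n : 0 < det3 (x - a) (b - a) n ->
  a != x /\ x != b.
Proof.
move=> D; split; apply: contraL D => /eqP <-.
  by rewrite -leNgt subrr det3E !coordE; lra.
suff -> : det3 (x - a) (x - a) n = 0 by rewrite ltxx.
by rewrite det3E; ring.
Qed.

(** Two successive edges of a face have increasing labels, unless the corner
between them is the starting vertex of the face. *)
Lemma corner_label P n F v (lab : set (vec3 R) -> int) a x b :
  anticlockwise P n F v ->
  sorted <%R [seq lab (segment p.1 p.2) | p <- sides v] ->
  F a -> F b -> 0 < det3 (x - a) (b - a) n ->
  edge P (segment a x) -> segment a x `<=` F ->
  edge P (segment x b) -> segment x b `<=` F ->
  x != head 0 v -> lab (segment a x) < lab (segment x b).
Proof.
move=> [uv vE vD] sv Fa Fb D eax axF exb xbF xv.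
have [ax xb] := segment_neq D.
have ax_v : (a, x) \in sides v.
  have [//|p pv /(segment_inj ax)] := (vE (segment a x)).1.
  case: p pv => p q /= pv [[-> ->] //|[ea ex]].
  have := vD _ _ pv Fb; rewrite /= -ea -ex.
  suff -> : det3 (a - x) (b - x) n = - det3 (x - a) (b - a) n.
    by rewrite oppr_ge0 leNgt D.
  by rewrite !det3E !coordE; ring.
have xb_v : (x, b) \in sides v.
  have [//|p pv /(segment_inj xb)] := (vE (segment x b)).1.
  case: p pv => p q /= pv [[-> ->] //|[ex eb]].
  have := vD _ _ pv Fa; rewrite /= -ex -eb.
  suff -> : det3 (x - b) (a - b) n = - det3 (x - a) (b - a) n.
    by rewrite oppr_ge0 leNgt D.
  by rewrite !det3E !coordE; ring.
exact: (sorted_sides (lab := fun p => lab (segment p.1 p.2)) uv sv ax_v xb_v xv).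
Qed.

(** An exposed point of [P] is an extreme point. *)
Lemma exposed_mem P n x (s : seq (vec3 R)) :
  supporting P n (conv_hull [:: x]) -> conv_hull s `<=` P -> conv_hull s x ->
  x \in s.
Proof.
move=> [_ [c Pc Px]] sP sx.
have nx : dot n x = c.
  have : conv_hull [:: x] x by apply: mem_conv_hull; rewrite inE.
  by rewrite Px => -[].
have : (conv_hull s `&` [set y | dot n y = c]) x by [].
rewrite conv_hull_exposed; last by move=> y /mem_conv_hull/sP/Pc.
case E: [seq y <- s | dot n y == c] => [|y s']; first by move=> /conv_hull0.
have : y \in [seq y <- s | dot n y == c] by rewrite E inE eqxx.
rewrite mem_filter => /andP[/eqP ny ys] _.
suff /conv_hull1 <- : conv_hull [:: x] y by [].
by rewrite Px; split=> //=; apply: sP; apply: mem_conv_hull.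
Qed.

Variable V : seq zvec.
Local Notation pos i := (evv R (vtx V i)).
Local Notation body := (conv_hull (map (evv R) V)).

Lemma vtx_inj : all (fun i => exposed V [:: i]) (iota 0 (size V)) ->
  {in gtn (size V) &, injective (fun i => pos i)}.
Proof.
move=> /allP ex i j; rewrite !inE => iV jV e.
have [|c [_ _ H _]] := @exposedP V R [:: i]; first by apply: ex; rewrite mem_iota.
have := H i iV; rewrite e H // !inE eqxx => /eqP ->.
by [].
Qed.

Lemma exposed_face f i : exposed V f -> i \in f ->
  zpos (zdet (vtx V (prev f i)) (vtx V i) (vtx V (next f i))) ->
  face body (evv R (vsum V f)) (conv_hull [seq pos i | i <- f])
  /\ 0 < det3 (pos i - pos (prev f i)) (pos (next f i) - pos (prev f i))
              (evv R (vsum V f)).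
Proof.
move=> Vf fi /(zpos_gt0 R); rewrite evv_det => D.
have [c [c0 _ H S]] := exposedP R Vf.
have /and4P[_ /allP fV _ _] := Vf.
split; last first.
  apply: (det3_oriented c0 D); apply/eqP; rewrite H ?mem_prev ?mem_next //;
  by apply: fV; rewrite ?mem_prev ?mem_next.
split=> //; exists (pos (prev f i)), (pos i), (pos (next f i)).
split; try by apply: mem_conv_hull; apply: map_f; rewrite ?mem_prev ?mem_next.
exact: det3_row_free D.
Qed.

Lemma exposed_edge i j : uniq [:: i; j] -> exposed V [:: i; j] ->
  all (fun i => exposed V [:: i]) (iota 0 (size V)) ->
  edge body (segment (pos i) (pos j)).
Proof.
move=> /= /andP[]; rewrite inE => ij _ Vij ex.
have [c [_ _ _ S]] := exposedP R Vij; have /and4P[_ /allP ijV _ _] := Vij.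
split; first by exists (evv R (vsum V [:: i; j])).
exists (pos i), (pos j); split=> //; apply: contra ij => /eqP/(vtx_inj ex) ->//;
  by apply: ijV; rewrite !inE eqxx ?orbT.
Qed.

(** Each face has only one starting vertex, and around a vertex of degree three
the labels cannot increase from each edge to the next one. Hence every vertex
is the starting vertex of a face, and there are at least as many faces as
vertices. *)
Lemma not_coherently_labellable Fs : face_cycles V Fs ->
  all (cubic_vertex Fs) (iota 0 (size V)) -> (size Fs < size V)%N ->
  ~ coherently_labellable body.
Proof.
case/and4P=> ex /allP FV /allP Fu /allP Fn /allP cub FsV [lab labP].
have /choice[h hP] : forall f, exists y : vec3 R, f \in Fs ->
    forall i, i \in f -> pos i != y ->
    lab (segment (pos (prev f i)) (pos i)) < lab (segment (pos i) (pos (next f i))).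
  move=> f; case fF : (f \in Fs); last by exists 0.
  have fV := FV _ fF; have /allP fn := Fn _ fF; have uf := Fu _ fF.
  have fi : head 0%N f \in f.
    by case: (f) fV => [|? ?] _ //=; rewrite inE eqxx.
  have /andP[_ /(exposed_face fV fi)[Ff _]] := fn _ fi.
  have [v [vF vs]] := labP _ _ Ff.
  exists (head 0 v) => _ i if_ iv.
  have /andP[Ein /(exposed_face fV if_)[_ D]] := fn _ if_.
  have /andP[Epi _] : exposed V [:: prev f i; next f (prev f i)] &&
     zpos (zdet (vtx V (prev f (prev f i))) (vtx V (prev f i))
                (vtx V (next f (prev f i)))).
    by apply: fn; rewrite mem_prev.
  rewrite next_prev // in Epi.
  have [/eqP pi /eqP ni] := segment_neq D.
  have sub (j k : nat) : j \in f -> k \in f ->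
      segment (pos j) (pos k) `<=` conv_hull [seq pos i | i <- f].
    move=> jf kf; apply: sub_conv_hull => y; rewrite !inE.
    by move=> /orP[] /eqP->; apply: map_f.
  apply: (corner_label vF vs _ _ D) => //.
  - by apply: mem_conv_hull; apply: map_f; rewrite mem_prev.
  - by apply: mem_conv_hull; apply: map_f; rewrite mem_next.
  - apply: exposed_edge => //=; rewrite inE andbT; apply: contra_notN pi.
    by move=> /eqP->.
  - by apply: sub; rewrite ?mem_prev.
  - apply: exposed_edge => //=; rewrite inE andbT; apply: contra_notN ni.
    by move=> /eqP <-.
  - by apply: sub; rewrite ?mem_next.
have sub : {subset [seq pos i | i <- iota 0 (size V)] <= map h Fs}.
  move=> y /mapP[i iV ->] {y}; apply: contraT => hi.
  have {}hP f : f \in Fs -> i \in f ->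
      lab (segment (pos (prev f i)) (pos i)) < lab (segment (pos i) (pos (next f i))).
    by move=> fF if_; apply: hP => //; apply: contra hi => /eqP->; apply: map_f.
  have /hasP[f1 F1 /hasP[f2 F2 /hasP[f3 F3]]] := cub _ iV.
  case/and5P=> i1 i2 i3 /eqP e12 /andP[/eqP e23 /eqP e31].
  have := hP _ F1 i1; rewrite e12 => h1.
  have := hP _ F2 i2; rewrite e23 => h2.
  have := hP _ F3 i3; rewrite e31 => h3.
  move: h1 h2 h3; rewrite ![segment (pos i) _]segmentC => h1 h2 h3.
  by have := lt_trans (lt_trans h1 h2) h3; rewrite ltxx.
have : uniq [seq pos i | i <- iota 0 (size V)].
  rewrite map_inj_in_uniq ?iota_uniq // => i j.
  by rewrite !mem_iota /= add0n => iV jV; apply: vtx_inj.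
move=> /uniq_leq_size/(_ sub); rewrite !size_map size_iota.
by rewrite leqNgt FsV.
Qed.

Lemma not_simplicial Fs : face_cycles V Fs ->
  has (fun f => 3 < size f)%N Fs -> ~ simplicial body.
Proof.
case/and4P=> ex /allP FV /allP Fu /allP Fn /hasP[f fF sf] simp.
have fV := FV _ fF; have /allP fn := Fn _ fF.
have fi : head 0%N f \in f by case: (f) sf => [|? ?] _ //=; rewrite inE eqxx.
have /andP[_ /(exposed_face fV fi)[Ff _]] := fn _ fi.
have [a [b [c Fabc]]] := simp _ _ Ff.
have /and4P[_ /allP fsV _ _] := fV.
have : uniq [seq pos i | i <- f].
  rewrite map_inj_in_uniq ?Fu // => i j /fsV iV /fsV jV; exact: vtx_inj.
move=> /uniq_leq_size => /(_ [:: a; b; c]).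
rewrite size_map leqNgt sf => H; have {H} // : false; apply: H.
move=> y /mapP[i if_ ->] {y}.
have [|d [_ _ _ S]] := @exposedP V R [:: i].
  by apply: (allP ex); rewrite mem_iota; apply: fsV.
apply: (exposed_mem S); rewrite -Fabc; last by apply: mem_conv_hull; apply: map_f.
apply: sub_conv_hull => y /mapP[j jf ->]; apply/vertexP; exists j => //.
exact: fsV.
Qed.

End Obstruction.

(** * Solids with triangular faces *)

Section Triangulated.
Variables (R : realType) (V : seq zvec) (Fs : seq (seq nat)).
Variables (Bs : seq (seq nat * seq nat)) (L : seq (nat * nat)).
Hypotheses (FsP : face_cycles V Fs) (BsP : triangulated V Fs Bs).
Implicit Types (n x : vec3 R) (F E : set (vec3 R)).

Local Notation pos i := (evv R (vtx V i)).
Local Notation body := (conv_hull (map (evv R) V)).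

Lemma mem_pos i : (i < size V)%N -> pos i \in map (evv R) V.
Proof. by move=> iV; apply/vertexP; exists i. Qed.

(** The face in a supporting plane is spanned by the vertices in this plane. *)
Lemma supporting_index n F : supporting body n F ->
  exists (c : R) (I : seq nat),
  [/\ I = [seq i <- iota 0 (size V) | dot n (pos i) == c],
    F = conv_hull [seq pos i | i <- I]
    & forall i, (i < size V)%N -> dot n (pos i) <= c].
Proof.
move=> /conv_hull_face[c [le ->]]; exists c; eexists; split=> //; last first.
  by move=> i /mem_pos/le.
apply: eq_conv_hull => v; rewrite mem_filter; apply/andP/mapP.
  move=> [nv /vertexP[i iV vi]]; exists i => //.
  by rewrite mem_filter mem_iota -vi nv.
move=> [i]; rewrite mem_filter mem_iota /= => /andP[ni iV] ->.
by split; rewrite ?mem_pos.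
Qed.

(** As the vertices sum to zero and span the space, the origin is strictly
below every supporting plane. *)
Lemma supporting_pos n (c : R) : n != 0 ->
  (forall i, (i < size V)%N -> dot n (pos i) <= c) -> 0 < c.
Proof.
move=> n0 le; rewrite ltNge; apply/negP => c0; case/eqP: n0.
have /and5P[Fs0 _ /eqP V0 _ _] := BsP.
have /and4P[_ /allP FV _ /allP Fn] := FsP.
have K : \sum_(i <- iota 0 (size V) | i \in iota 0 (size V)) - dot n (pos i) = 0.
  by rewrite -big_seq sumrN -dot_sumr -evv_vsum V0 evv0 dot0r oppr0.
have nV i : (i < size V)%N -> dot n (pos i) = 0.
  move=> iV; move/eqP: K; rewrite psumr_eq0 => [/allP/(_ i)|j].
    by rewrite mem_iota /= iV oppr_eq0 => /(_ isT)/eqP.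
  by rewrite mem_iota oppr_ge0 => /le h; apply: le_trans c0.
case: Fs Fs0 FV Fn => // f Fs' _ /(_ f) + /(_ f).
rewrite inE eqxx => /(_ isT) /and4P[f0 /allP fV _ _] /(_ isT) /allP fn.
have fi : head 0%N f \in f by case: (f) f0 => [|? ?] //=; rewrite inE eqxx.
have /andP[_ /(zpos_gt0 R)] := fn _ fi; rewrite evv_det => D.
by apply: (det3_eq0 D); apply: nV; apply: fV; rewrite ?mem_prev ?mem_next.
Qed.

Lemma blocker_notin n (c : R) BB : blocker V BB -> 0 < c ->
  (forall i, (i < size V)%N -> dot n (pos i) <= c) ->
  ~ {in BB.1, forall i, dot n (pos i) = c}.
Proof.
case: BB => B B' /and4P[/= B0 BB' /allP B'V /eqP e] c0 le H.
have {e} : dot n (evv R (zvscale (0, 1) (vsum V B))) = dot n (evv R (vsum V B')).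
  by rewrite e.
rewrite evvZ dotZr !evv_vsum !dot_sumr (eq_big_seq (fun=> c)) //.
have -> : ev R (0, 1) = golden R by rewrite /ev /=; ring.
have : \sum_(i <- B') dot n (pos i) <= \sum_(i <- B') c.
  by rewrite !big_seq; apply: ler_sum => i /B'V/le.
rewrite !big_const_seq !count_predT !iter_addr_0 => h1 h2.
have h3 : c *+ size B' <= c *+ size B by apply: ler_wpMn2l => //; exact: ltW.
have h4 : 0 < c *+ size B by rewrite pmulrn_lgt0.
have := golden_gt1 R; rewrite -(ltr_pM2r h4) mul1r h2 => h5.
by have := lt_le_trans h5 (le_trans h1 h3); rewrite ltxx.
Qed.

Lemma face_triangle n F : face body n F -> exists (c : R) (f : seq nat),
  [/\ f \in Fs, 0 < c, F = conv_hull [seq pos i | i <- f]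
    & forall i, (i < size V)%N -> (dot n (pos i) == c) = (i \in f)].
Proof.
move=> [nF ncF]; have [c [I [IE FE le]]] := supporting_index nF.
have c0 : 0 < c by apply: supporting_pos le; case: nF.
have memI i : (i < size V)%N -> (dot n (pos i) == c) = (i \in I).
  by move=> iV; rewrite IE mem_filter mem_iota /= iV andbT.
have /and5P[_ _ _ /allP bl /allP/(_ I)] := BsP.
rewrite {1}IE => /(_ (filter_subseqs _ _)) /or3P[|/hasP[f fF]|/hasP[BB /bl blB]].
- rewrite leqNgt; move: ncF; rewrite FE => /noncollinear_size.
  by rewrite size_map => ->.
- case/andP=> /eqP sI /allP If.
  have uI : uniq I by rewrite IE filter_uniq ?iota_uniq.
  have [|_ eI] := uniq_min_size uI If; first by rewrite sI.
  exists c, f; split=> //; last by move=> i /memI->; rewrite eI.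
  by rewrite FE; apply: eq_conv_hull; exact: eq_mem_map.
- move=> /allP BI; case: (blocker_notin blB c0 le) => i /BI /=.
  by rewrite IE mem_filter => /andP[/eqP].
Qed.

Lemma triangulated_simplicial : simplicial body.
Proof.
move=> n F /face_triangle[c [f [fF _ -> _]]].
have /and5P[_ /allP/(_ f fF) + _ _ _] := BsP.
case: f {fF} => [|i [|j [|k [|? ?]]]] // _.
by exists (pos i), (pos j), (pos k).
Qed.

Hypothesis LP : sorted_labels V Fs L.

Lemma segment_pos_inj p q :
  (p.1 < size V)%N -> (p.2 < size V)%N -> (q.1 < size V)%N -> (q.2 < size V)%N ->
  p.1 != p.2 -> segment (pos q.1) (pos q.2) = segment (pos p.1) (pos p.2) ->
  q = p \/ q = (p.2, p.1).
Proof.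
have /and4P[ex _ _ _] := FsP; have inj := @vtx_inj R V ex.
case: p q => [i j] [k l] /= iV jV kV lV ij /esym/segment_inj[|[]|[]].
- by apply: contra ij => /eqP/inj->.
- by move=> /inj-> // /inj->//; left.
- by move=> /inj-> // /inj->//; right.
Qed.

(** The edges inside a triangular face are its three sides. *)
Lemma triangle_edge n F E (c : R) f : noncollinear F -> uniq f -> size f = 3%N ->
  F = conv_hull [seq pos i | i <- f] -> F `<=` [set x | dot n x = c] ->
  (forall i, (i < size V)%N -> (dot n (pos i) == c) = (i \in f)) ->
  edge body E -> E `<=` F ->
  exists i j, [/\ i \in f, j \in f, i != j & E = segment (pos i) (pos j)].
Proof.
move=> ncF uf sf FE Fc memf [[m mE] [a [b [ab Eab]]]] EF.
have [d [I [IE EI _]]] := supporting_index mE.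
have uI : uniq I by rewrite IE filter_uniq ?iota_uniq.
have If : {subset I <= f}.
  move=> i iI; rewrite -memf; last by move: iI; rewrite IE mem_filter mem_iota => /andP[].
  by apply/eqP; apply: Fc; apply: EF; rewrite EI; apply: mem_conv_hull; apply: map_f.
have : (size I < 3)%N.
  rewrite ltnNge -sf; apply/negP => fI; have [_ eI] := uniq_min_size uI If fI.
  apply: (@segment_collinear R a b); rewrite -Eab EI.
  suff <- : F = conv_hull [seq pos i | i <- I] by [].
  by rewrite FE; apply: eq_conv_hull => v; apply/esym; exact: eq_mem_map.
have Ea : E a by rewrite Eab; exact: segmentl.
have Eb : E b by rewrite Eab; exact: segmentr.
case: I EI uI If {IE} => [|i [|j [|? ?]]] // EI uI If _.
- by move: Ea; rewrite EI => /conv_hull0.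
- move: Ea Eb ab; rewrite EI => /conv_hull1-> /conv_hull1->.
  by rewrite eqxx.
- exists i, j; split=> //; try by apply: If; rewrite !inE eqxx ?orbT.
  by move: uI; rewrite /= inE andbT.
Qed.

Lemma triangulated_coherently_labellable : coherently_labellable body.
Proof.
have /and4P[ex /allP FV /allP Fu /allP Fn] := FsP.
have /andP[/allP LV /allP Lsort] := LP.
have /and5P[_ /allP F3 _ _ _] := BsP.
exists (fun E => Posz (find (fun e => `[< segment (pos e.1) (pos e.2) = E >]) L)).
move=> n F nF; have [c [f [fF c0 FE memf]]] := face_triangle nF.
have := F3 _ fF; have := Lsort _ fF; have uf := Fu _ fF; have /allP fn := Fn _ fF.
have /and4P[_ /allP fV _ _] := FV _ fF.
have Fc : F `<=` [set x | dot n x = c].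
  rewrite FE => x; apply: conv_hull_eq => _ /mapP[i if_ ->].
  by apply/eqP; rewrite memf // fV.
have tri E := @triangle_edge n F E c f nF.2 uf.
case: f => [|i [|j [|k [|? ?]]]] // in fF FE memf uf fn fV tri *.
move=> Ls _; have {}tri E := tri E erefl FE Fc memf.
have iV : (i < size V)%N by apply: fV; rewrite !inE eqxx.
have jV : (j < size V)%N by apply: fV; rewrite !inE eqxx ?orbT.
have kV : (k < size V)%N by apply: fV; rewrite !inE eqxx ?orbT.
have [ij [ik jk]] : i != j /\ i != k /\ j != k.
  by move: uf; rewrite /= !inE !negb_or => /and3P[/andP[-> ->] ->].
have [ji ki kj] : [/\ j != i, k != i & k != j] by rewrite ![_ == i]eq_sym [k == j]eq_sym.
have nE := (negPf ij, negPf ik, negPf jk, negPf ji, negPf ki, negPf kj).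
have D : 0 < det3 (pos j - pos i) (pos k - pos i) n.
  apply: (det3_oriented c0); try by apply/eqP; rewrite memf // !inE eqxx ?orbT.
  have /andP[_ /(zpos_gt0 R)] : exposed V [:: j; next [:: i; j; k] j] &&
    zpos (zdet (vtx V (prev [:: i; j; k] j)) (vtx V j) (vtx V (next [:: i; j; k] j))).
    by apply: fn; rewrite !inE eqxx orbT.
  by rewrite evv_det /= !nE !eqxx.
have nxt : [/\ next [:: i; j; k] i = j, next [:: i; j; k] j = k
             & next [:: i; j; k] k = i].
  by rewrite /= !nE !eqxx.
have edges l : l \in [:: i; j; k] -> exposed V [:: l; next [:: i; j; k] l].
  by move=> /fn /andP[].
have [ni nj nk] := nxt.
have := edges i; have := edges j; have := edges k.
rewrite ni nj nk !inE !eqxx ?orbT => /(_ isT) xki /(_ isT) xjk /(_ isT) xij.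
have eij : edge body (segment (pos i) (pos j)).
  by apply: exposed_edge => //=; rewrite inE andbT.
have ejk : edge body (segment (pos j) (pos k)).
  by apply: exposed_edge => //=; rewrite inE andbT.
have eki : edge body (segment (pos k) (pos i)).
  by apply: exposed_edge => //=; rewrite inE andbT.
exists [:: pos i; pos j; pos k]; split; last first.
  move: Ls; rewrite /sides !rot1_cons /=.
  have lab p : (p.1 < size V)%N -> (p.2 < size V)%N -> p.1 != p.2 ->
     find (fun e => `[< segment (pos e.1) (pos e.2) = segment (pos p.1) (pos p.2) >]) L
     = edge_label L p.
    move=> p1 p2 p12; apply: eq_in_find => e /LV/andP[e1 e2].
    apply/asboolP/idP; first by move=> /segment_pos_inj[]// ->; rewrite eqxx ?orbT.
    by move=> /orP[]/eqP-> //=; rewrite segmentC.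
  rewrite (lab (i, j)) // (lab (j, k)) // (lab (k, i)) //.
split.
- have inj := @vtx_inj R V ex.
  have neq l m : (l < size V)%N -> (m < size V)%N -> l != m -> pos l != pos m.
    by move=> lV mV; apply: contra => /eqP/inj->.
  by rewrite /= !inE negb_or !neq.
- move=> E; split.
    move=> [eE EF]; have [l [m [lf mf lm ->]]] := tri E eE EF.
    rewrite /sides rot1_cons /=.
    have side p : p \in [:: (i, j); (j, k); (k, i)] -> exists2 q,
      q \in [:: (pos i, pos j); (pos j, pos k); (pos k, pos i)] &
      segment (pos p.1) (pos p.2) = segment q.1 q.2.
      move=> pf; exists (pos p.1, pos p.2) => //.
      by have := map_f (fun p => (pos p.1, pos p.2)) pf.
    have : (l, m) \in [:: (i, j); (j, k); (k, i)] \/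
           (m, l) \in [:: (i, j); (j, k); (k, i)].
      move: lf mf lm; rewrite !inE => /or3P[]/eqP-> /or3P[]/eqP->;
        rewrite ?eqxx ?orbT //; by [left|right].
    case=> [/side //|/side[q qs]].
    by rewrite /= segmentC => ->; exists q.
  rewrite /sides rot1_cons /= => -[q]; rewrite !inE.
  have sub l m : l \in [:: i; j; k] -> m \in [:: i; j; k] ->
      segment (pos l) (pos m) `<=` F.
    move=> lf mf; rewrite FE; apply: sub_conv_hull => v; rewrite in_cons mem_seq1.
    by move=> /orP[]/eqP->; apply: (map_f (fun i => pos i)).
  by move=> /or3P[]/eqP-> /= ->; split=> //; apply: sub; rewrite !inE eqxx ?orbT.
- move=> q x; rewrite /sides rot1_cons /= FE => qf Fx.
  have left_of p q' r : 0 < det3 (q' - p) (r - p) n ->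
      conv_hull [:: p; q'; r] x -> 0 <= det3 (q' - p) (x - p) n.
    move=> D'; apply: det3_conv_hull => y; rewrite !inE => /or3P[]/eqP->.
    - by rewrite le_eqVlt (_ : det3 _ _ _ = 0) ?eqxx // det3E !coordE; ring.
    - by rewrite le_eqVlt (_ : det3 _ _ _ = 0) ?eqxx // det3E !coordE; ring.
    - exact: ltW.
  move: qf; rewrite !inE => /or3P[]/eqP-> /=.
  + exact: left_of D Fx.
  + apply: (left_of _ _ (pos i)); last first.
      by apply: sub_conv_hull Fx => y; rewrite !inE => /or3P[]->; rewrite ?orbT.
    by move: D; rewrite !det3E !coordE; congr (0 < _); ring.
  + apply: (left_of _ _ (pos j)); last first.
      by apply: sub_conv_hull Fx => y; rewrite !inE => /or3P[]->; rewrite ?orbT.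
    by move: D; rewrite !det3E !coordE; congr (0 < _); ring.
Qed.

End Triangulated.

(** * The five platonic solids *)

Local Open Scope nat_scope.

(** The vertices are those of the standard models, in the same order. The cycles
list the vertices of the faces anticlockwise as seen from outside, those of
the labelled solids from their starting vertex. The elements [zg] and [zh] of
Z[g] stand for the golden ratio and its inverse. *)
Definition z0 : zphi := (0%R, 0%R).
Definition z1 : zphi := (1%R, 0%R).
Definition zN1 : zphi := ((-1)%R, 0%R).
Definition zg : zphi := (0%R, 1%R).
Definition zNg : zphi := (0%R, (-1)%R).
Definition zh : zphi := ((-1)%R, 1%R).
Definition zNh : zphi := (1%R, (-1)%R).

Definition tetrahedron_zvertices : seq zvec :=
  [:: (z1, z1, z1); (z1, zN1, zN1); (zN1, z1, zN1); (zN1, zN1, z1)].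

Definition tetrahedron_cycles : seq (seq nat) :=
  [:: [:: 0; 1; 2]; [:: 1; 0; 3]; [:: 3; 0; 2]; [:: 2; 1; 3]].

Definition tetrahedron_edges : seq (nat * nat) :=
  [:: (0, 1); (1, 2); (0, 3); (1, 3); (0, 2); (2, 3)].

Definition tetrahedron_blockers : seq (seq nat * seq nat) :=
  [:: ([:: 0; 1; 2; 3], [::])].

Definition octahedron_zvertices : seq zvec :=
  [:: (z1, z0, z0); (zN1, z0, z0); (z0, z1, z0); (z0, zN1, z0); (z0, z0, z1);
      (z0, z0, zN1)].

Definition octahedron_cycles : seq (seq nat) :=
  [:: [:: 0; 2; 4]; [:: 0; 5; 2]; [:: 4; 3; 0]; [:: 5; 0; 3]; [:: 1; 4; 2];
      [:: 2; 5; 1]; [:: 1; 3; 4]; [:: 3; 1; 5]].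

Definition octahedron_edges : seq (nat * nat) :=
  [:: (1, 3); (0, 5); (2, 5); (3, 4); (0, 3); (0, 2); (1, 4); (1, 5); (2, 4);
      (0, 4); (1, 2); (3, 5)].

Definition octahedron_blockers : seq (seq nat * seq nat) :=
  [:: ([:: 0; 1], [::]); ([:: 2; 3], [::]); ([:: 4; 5], [::])].

Definition icosahedron_zvertices : seq zvec :=
  [:: (z0, z1, zg); (z0, z1, zNg); (z0, zN1, zg); (z0, zN1, zNg); (z1, zg, z0);
      (z1, zNg, z0); (zN1, zg, z0); (zN1, zNg, z0); (zg, z0, z1);
      (zNg, z0, z1); (zg, z0, zN1); (zNg, z0, zN1)].

Definition icosahedron_cycles : seq (seq nat) :=
  [:: [:: 2; 8; 0]; [:: 2; 0; 9]; [:: 0; 4; 6]; [:: 0; 8; 4]; [:: 6; 9; 0];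
      [:: 10; 3; 1]; [:: 3; 11; 1]; [:: 4; 1; 6]; [:: 1; 4; 10]; [:: 6; 1; 11];
      [:: 7; 5; 2]; [:: 8; 2; 5]; [:: 9; 7; 2]; [:: 5; 7; 3]; [:: 3; 10; 5];
      [:: 7; 11; 3]; [:: 4; 8; 10]; [:: 5; 10; 8]; [:: 9; 6; 11];
      [:: 11; 7; 9]].

Definition icosahedron_edges : seq (nat * nat) :=
  [:: (2, 8); (3, 10); (0, 8); (0, 2); (4, 8); (0, 4); (1, 4); (7, 11); (6, 9);
      (5, 7); (0, 9); (3, 11); (1, 6); (3, 7); (5, 10); (3, 5); (2, 5); (4, 6);
      (7, 9); (0, 6); (8, 10); (2, 7); (1, 11); (4, 10); (6, 11); (5, 8);
      (1, 3); (2, 9); (9, 11); (1, 10)].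

Definition icosahedron_blockers : seq (seq nat * seq nat) :=
  [:: ([:: 0; 1], [:: 4; 6]); ([:: 0; 3], [::]); ([:: 0; 5], [:: 2; 8]);
      ([:: 0; 7], [:: 2; 9]); ([:: 0; 10], [:: 4; 8]); ([:: 0; 11], [:: 6; 9]);
      ([:: 1; 2], [::]); ([:: 1; 5], [:: 3; 10]); ([:: 1; 7], [:: 3; 11]);
      ([:: 1; 8], [:: 4; 10]); ([:: 1; 9], [:: 6; 11]); ([:: 2; 3], [:: 5; 7]);
      ([:: 2; 4], [:: 0; 8]); ([:: 2; 6], [:: 0; 9]); ([:: 2; 10], [:: 5; 8]);
      ([:: 2; 11], [:: 7; 9]); ([:: 3; 4], [:: 1; 10]);
      ([:: 3; 6], [:: 1; 11]); ([:: 3; 8], [:: 5; 10]);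
      ([:: 3; 9], [:: 7; 11]); ([:: 4; 5], [:: 8; 10]); ([:: 4; 7], [::]);
      ([:: 4; 9], [:: 0; 6]); ([:: 4; 11], [:: 1; 6]); ([:: 5; 6], [::]);
      ([:: 5; 9], [:: 2; 7]); ([:: 5; 11], [:: 3; 7]); ([:: 6; 7], [:: 9; 11]);
      ([:: 6; 8], [:: 0; 4]); ([:: 6; 10], [:: 1; 4]); ([:: 7; 8], [:: 2; 5]);
      ([:: 7; 10], [:: 3; 5]); ([:: 8; 9], [:: 0; 2]); ([:: 8; 11], [::]);
      ([:: 9; 10], [::]); ([:: 10; 11], [:: 1; 3])].

Definition cube_zvertices : seq zvec :=
  [:: (z1, z1, z1); (z1, z1, zN1); (z1, zN1, z1); (z1, zN1, zN1);
      (zN1, z1, z1); (zN1, z1, zN1); (zN1, zN1, z1); (zN1, zN1, zN1)].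

Definition cube_cycles : seq (seq nat) :=
  [:: [:: 0; 2; 3; 1]; [:: 0; 1; 5; 4]; [:: 0; 4; 6; 2]; [:: 1; 3; 7; 5];
      [:: 2; 6; 7; 3]; [:: 4; 5; 7; 6]].

Definition dodecahedron_zvertices : seq zvec :=
  [:: (z1, z1, z1); (z1, z1, zN1); (z1, zN1, z1); (z1, zN1, zN1);
      (zN1, z1, z1); (zN1, z1, zN1); (zN1, zN1, z1); (zN1, zN1, zN1);
      (z0, zh, zg); (z0, zh, zNg); (z0, zNh, zg); (z0, zNh, zNg); (zh, zg, z0);
      (zh, zNg, z0); (zNh, zg, z0); (zNh, zNg, z0); (zg, z0, zh);
      (zNg, z0, zh); (zg, z0, zNh); (zNg, z0, zNh)].

Definition dodecahedron_cycles : seq (seq nat) :=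
  [:: [:: 0; 16; 18; 1; 12]; [:: 0; 8; 10; 2; 16]; [:: 0; 12; 14; 4; 8];
      [:: 1; 18; 3; 11; 9]; [:: 1; 9; 5; 14; 12]; [:: 2; 13; 3; 18; 16];
      [:: 2; 10; 6; 15; 13]; [:: 3; 13; 15; 7; 11]; [:: 4; 14; 5; 19; 17];
      [:: 4; 17; 6; 10; 8]; [:: 5; 9; 11; 7; 19]; [:: 6; 17; 19; 7; 15]].

Local Open Scope ring_scope.

Section Solids.
Variable R : realType.

Lemma evz0 : ev R z0 = 0. Proof. by rewrite /ev /=; ring. Qed.
Lemma evz1 : ev R z1 = 1. Proof. by rewrite /ev /=; ring. Qed.
Lemma evzN1 : ev R zN1 = -1. Proof. by rewrite /ev /=; ring. Qed.
Lemma evzg : ev R zg = golden R. Proof. by rewrite /ev /=; ring. Qed.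
Lemma evzNg : ev R zNg = - golden R. Proof. by rewrite /ev /=; ring. Qed.
Lemma evzh : ev R zh = (golden R)^-1.
Proof. by rewrite golden_inv /ev /=; ring. Qed.
Lemma evzNh : ev R zNh = - (golden R)^-1.
Proof. by rewrite golden_inv /ev /=; ring. Qed.

Definition evzE := (evz0, evz1, evzN1, evzg, evzNg, evzh, evzNh).

Lemma tetrahedronE : tetrahedron_vertices R = map (evv R) tetrahedron_zvertices.
Proof. by rewrite /= /evv /= !evzE. Qed.

Lemma octahedronE : octahedron_vertices R = map (evv R) octahedron_zvertices.
Proof. by rewrite /= /evv /= !evzE. Qed.

Lemma icosahedronE : icosahedron_vertices R = map (evv R) icosahedron_zvertices.
Proof. by rewrite /= /evv /= !evzE. Qed.

Lemma cubeE : cube_vertices R = map (evv R) cube_zvertices.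
Proof. by rewrite /= /evv /= !evzE. Qed.

Lemma dodecahedronE : dodecahedron_vertices R = map (evv R) dodecahedron_zvertices.
Proof. by rewrite /dodecahedron_vertices /= /evv /= !evzE. Qed.

Lemma similar_labellable (V : seq zvec) Fs Bs L P :
  face_cycles V Fs -> triangulated V Fs Bs -> sorted_labels V Fs L ->
  similar_bodies P (conv_hull (map (evv R) V)) ->
  simplicial P /\ coherently_labellable P.
Proof.
move=> FsP BsP LP PV; split.
  by apply: (similar_simplicial PV); apply: triangulated_simplicial FsP BsP.
apply: (similar_coherent PV).
exact: triangulated_coherently_labellable FsP BsP LP.
Qed.

Lemma similar_unlabellable (V : seq zvec) Fs P :
  face_cycles V Fs -> all (cubic_vertex Fs) (iota 0 (size V)) ->
  (size Fs < size V)%N -> has (fun f => 3 < size f)%N Fs ->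
  similar_bodies P (conv_hull (map (evv R) V)) ->
  ~ simplicial P /\ ~ coherently_labellable P.
Proof.
move=> FsP cub FsV big /similar_bodies_sym VP; split.
  by move/(similar_simplicial VP); apply: not_simplicial FsP big.
by move/(similar_coherent VP); apply: not_coherently_labellable FsP cub FsV.
Qed.

End Solids.

Theorem theorem8p1 (R : realType) :
  (forall P : set (vec3 R),
     tetrahedron P \/ octahedron P \/ icosahedron P ->
     simplicial P /\ coherently_labellable P) /\
  (forall P : set (vec3 R),
     dodecahedron P \/ cube P ->
     ~ simplicial P /\ ~ coherently_labellable P).
Proof.
split=> P.
  case=> [|[]].
  - rewrite /tetrahedron tetrahedronE.
    apply: (@similar_labellable _ _ tetrahedron_cycles tetrahedron_blockers
      tetrahedron_edges); by vm_compute.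
  - rewrite /octahedron octahedronE.
    apply: (@similar_labellable _ _ octahedron_cycles octahedron_blockers
      octahedron_edges); by vm_compute.
  - rewrite /icosahedron icosahedronE.
    apply: (@similar_labellable _ _ icosahedron_cycles icosahedron_blockers
      icosahedron_edges); by vm_compute.
case.
- rewrite /dodecahedron dodecahedronE.
  apply: (@similar_unlabellable _ _ dodecahedron_cycles); by vm_compute.
- rewrite /cube cubeE.
  apply: (@similar_unlabellable _ _ cube_cycles); by vm_compute.
Qed.
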